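(* Let $m > 1$ be an integer and $a$ an integer such that $\gcd(a,m)$ is square-free, and let $\gamma \in \{\pi/4, 3\pi/4\}$. Then the congruence class of $a$ modulo $m$ contains infinitely many square-free $\gamma$-congruent numbers.
   Context: For $\theta \in \{\pi/4,3\pi/4\}$, a positive integer $n$ is $\theta$-congruent if there exist positive rationals $a,b,c$ such that the triangle with sides $a$, $b\sqrt2$, $c$ has angle $\theta$ opposite $c$ and area $n$; equivalently $ab = 2n$ and $c^2 = a^2+2b^2-2ab$ (for $\theta = \pi/4$), resp. $c^2 = a^2+2b^2+2ab$ (for $\theta=3\pi/4$). *)

(* Defs.v *)
From HB Require Import structures.
From mathcomp Require Import all_boot all_order all_algebra.
Set Implicit Arguments. Unset Strict Implicit. Unset Printing Implicit Defensive.
Import Order.TTheory GRing.Theory Num.Theory.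
Local Open Scope ring_scope.

Inductive angle := PiOver4 | ThreePiOver4.

(* Law of cosines with cos(pi/4) = 1/sqrt 2, sides a, b*sqrt 2, c:
   c^2 = a^2 + 2 b^2 - 2ab  (theta = pi/4)
   c^2 = a^2 + 2 b^2 + 2ab  (theta = 3pi/4);
   area = (1/2) a (b sqrt 2) sin theta = ab/2. *)
Definition law_of_cosines (th : angle) (a b c : rat) : Prop :=
  match th with
  | PiOver4 => c ^+ 2 = a ^+ 2 + 2 * b ^+ 2 - 2 * a * b
  | ThreePiOver4 => c ^+ 2 = a ^+ 2 + 2 * b ^+ 2 + 2 * a * b
  end.

Definition theta_congruent (th : angle) (n : nat) : Prop :=
  (0 < n)%N /\
  exists a b c : rat, 0 < a /\ 0 < b /\ 0 < c /\
    a * b = 2 * n%:R /\ law_of_cosines th a b c.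

(* Square-free natural number: no square d^2 > 1 divides it (so 0 is not). *)
Definition squarefree (n : nat) : Prop :=
  forall d : nat, (d * d %| n)%N -> d = 1%N.

(* Main.v *)
Require Import Defs.
From mathcomp Require Import all_boot all_order all_algebra.
From mathcomp Require Import zify ring lra.
Import Order.TTheory GRing.Theory Num.Theory.

(** Completing the square, the law of cosines reads c^2 = (a -+ b)^2 + b^2, so
    up to scaling a = u^2 +- 2 u V - V^2 and b = 2 u V: the theta-congruent
    numbers are the positive values of u V (u^2 +- 2 u V - V^2) up to rational
    squares.  Put V = r^2 v with r divisible by m and by all small primes.  After
    dividing by r^2 one gets n = u v Q with Q = u^2 +- 2 r^2 u v - r^4 v^2, and
    n = v modulo r as soon as u = 1 modulo r.  Hence u = 1 and v = t modulo r^2,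
    where t = a modulo m and t has no square factor p^2 with p dividing r, takes
    care of the residue class and of the primes dividing r.  For a prime p not
    dividing r, at most 8 Y (Y / p^2 + 1) of the Y^2 pairs (u, v) in a box of
    side Y have p^2 | n, and only p = O(Y) matters because Q is quadratic.
    Summing over p leaves good pairs, because sum p^-2 over large p is small and
    pi(x) = o(x), which follows from the bound 4^x for the primorial. *)

(** * Primorial bound and density of the primes *)

Lemma dvdn_prod_primes (r : seq nat) (N : nat) :
  uniq r -> all prime r -> all (dvdn^~ N) r -> \prod_(p <- r) p %| N.
Proof.
elim: r => [|p r IHr] /=; first by rewrite big_nil dvd1n.
move=> /andP[pr ur] /andP[prp prr] /andP[pN rN].
rewrite big_cons Gauss_dvd; first by rewrite pN IHr.
rewrite big_seq; elim/big_ind: _ => [|x y cx cy|q qr]; first exact: coprimen1.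
  by rewrite coprimeMr cx cy.
rewrite prime_coprime // dvdn_prime2 ?(allP prr q) //.
by apply: contraNneq pr => ->.
Qed.

(** The two equal middle coefficients of row 2k+1 add up to at most 2^(2k+1). *)
Lemma bin_odd_le_exp4 (k : nat) : 'C(k.*2.+1, k) <= 4 ^ k.
Proof.
have := Pascal 1 1 k.*2.+1; rewrite (_ : 1 + 1 = 2) //.
have k1 : k < k.*2.+2 by lia.
have k2 : k.+1 < k.*2.+2 by lia.
rewrite (bigD1 (Ordinal k1)) //= (bigD1 (Ordinal k2)) /=; last first.
  by apply/eqP => /(congr1 val) /=; lia.
have -> : 'C(k.*2.+1, k.+1) = 'C(k.*2.+1, k).
  by rewrite -bin_sub; [congr 'C(_, _)|]; lia.
rewrite !exp1n !muln1 => E.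
have : 'C(k.*2.+1, k) + 'C(k.*2.+1, k) <= 2 ^ k.*2.+1.
  by rewrite E addnA leq_addr.
by rewrite expnS -mul2n expnM -[2 ^ 2]/4; lia.
Qed.

(** Erdős's induction: an even n > 2 adds no prime, and for n = 2k+1 the primes from k+2 to n all
    divide C(2k+1, k) <= 4^k, while those up to k+1 fall under the induction hypothesis. *)
Lemma primorial_le_exp4 (n : nat) : \prod_(0 <= p < n.+1 | prime p) p <= 4 ^ n.
Proof.
elim/ltn_ind: n => n IHn.
have [n2|n2] := leqP n 2.
  by case: n n2 {IHn} => [|[|[|//]]] _; rewrite unlock.
have [on|en] := boolP (odd n); last first.
  have npr : ~~ prime n.
    by apply: contra en => prn; case: (even_prime prn) => [E|//]; lia.
  rewrite big_mkcond big_nat_recr //= (negbTE npr) muln1 -big_mkcond /=.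
  case: n n2 IHn {en npr} => // n _ IHn.
  by rewrite (leq_trans (IHn n _)) ?leq_exp2l.
have [k nE] : exists k, n = k.*2.+1 by exists n./2; lia.
rewrite nE (big_cat_nat _ (n := k.+2)) //=; last by lia.
rewrite (_ : 4 ^ k.*2.+1 = 4 ^ k.+1 * 4 ^ k); last by rewrite -expnD; congr (4 ^ _); lia.
apply: leq_mul; first by apply: IHn; lia.
apply: leq_trans (bin_odd_le_exp4 k).
apply: dvdn_leq; first by rewrite bin_gt0; lia.
rewrite -big_filter; apply: dvdn_prod_primes.
- by rewrite filter_uniq // iota_uniq.
- exact: filter_all.
apply/allP => p; rewrite mem_filter mem_index_iota => /andP[prp /andP[pk pn]].
(* (2k+1)! = C(2k+1, k) k! (k+1)!, and p > k+1 divides neither small factorial. *)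
have: p %| (k.*2.+1)`! by rewrite dvdn_fact //; lia.
have kn : k <= k.*2.+1 by lia.
rewrite -(bin_fact kn) !Euclid_dvdM // => /orP[//|].
have fact_small q : q < p -> (p %| q`!) = false.
  elim: q => [|q IHq] qp; first by rewrite Euclid_dvd1.
  by rewrite factS Euclid_dvdM // IHq 1?ltnW // orbF gtnNdvd.
by rewrite !fact_small //; lia.
Qed.

(* The primes in ]4 ^ L, n] contribute at least (4 ^ L) ^ (pi(n) - 4 ^ L) to
   the primorial of n, which gives pi(n) <= 4 ^ L + n / L for every L. *)
Lemma prime_count_littleo (K : nat) :
  exists n0, forall n, n0 <= n -> K * \sum_(0 <= p < n.+1 | prime p) 1 <= n.
Proof.
case: K => [|K0]; first by exists 0.
set K := K0.+1; set L := K.*2; set w := 4 ^ L.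
(* As L = 2K, the primes above [w] account for at most n/2 of the product, and those up to [w] for
   at most K(w+1) <= n/2. *)
exists (2 * K * w.+1) => n nw.
have wn : w.+1 <= n.+1 by rewrite -/K; nia.
rewrite (big_cat_nat _ (n := w.+1)) //=.
set s1 := (X in X + _); set s2 := (X in _ + X).
have s1w : s1 <= w.+1.
  rewrite /s1 big_mkcond (leq_trans (n := \sum_(0 <= p < w.+1) 1)) //.
    by apply: leq_sum => i _; case: prime.
  by rewrite sum_nat_const_nat subn0 muln1.
have s2n : L * s2 <= n.
  rewrite -(@leq_exp2l 4) // expnM (leq_trans _ (primorial_le_exp4 n)) //.
  rewrite (big_cat_nat _ (n := w.+1)) //= -[X in X <= _]mul1n leq_mul //.
    by apply: prodn_cond_gt0 => p; apply: prime_gt0.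
  rewrite -/w /s2 expn_sum [X in X <= _]big_nat_cond [X in _ <= X]big_nat_cond.
  by apply: leq_prod => p /andP[/andP[wp _] _]; rewrite expn1 ltnW.
have -> : K * (s1 + s2) = K * s1 + K * s2 by rewrite mulnDr.
rewrite /L in s2n; nia.
Qed.

(** * Elementary counting bounds *)

(** Telescoping: Y/p^2 <= Y/(p-1) - Y/p. The induction keeps the subtracted last term. *)
Lemma sum_div_square_le (Y z k : nat) :
  0 < z -> z * \sum_(z.+1 <= p < k) Y %/ (p * p) <= Y.
Proof.
move=> z0.
have [kz|zk] := leqP k z.+1; first by rewrite big_geq // muln0.
suff H : ((\sum_(z.+1 <= p < k) Y %/ (p * p))%N%:R <= Y%:R / z%:R :> rat)%R.
  by rewrite -(ler_nat rat) natrM mulrC -ler_pdivlMr ?ltr0n.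
have {zk} : z.+1 <= k by apply: ltnW.
suff H : z.+1 <= k -> ((\sum_(z.+1 <= p < k) Y %/ (p * p))%N%:R
    <= Y%:R / z%:R - Y%:R / (k.-1)%:R :> rat)%R.
  by move=> /H /le_trans; apply; rewrite gerBl divr_ge0 ?ler0n.
elim: k => // k IHk; rewrite leq_eqVlt => /orP[/eqP[<-]|zk].
  by rewrite big_geq //= subrr.
rewrite big_nat_recr //= natrD; move: (IHk zk) => {}IHk.
have [j kE] : exists j, k = j.+2 by exists k.-2; lia.
rewrite kE /= in IHk *.
suff H : ((Y %/ (j.+2 * j.+2))%N%:R <= Y%:R / j.+1%:R - Y%:R / j.+2%:R :> rat)%R.
  by apply: le_trans (lerD IHk H) _; rewrite addrA subrK.
have le1 : ((Y %/ (j.+2 * j.+2))%N%:R <= Y%:R / (j.+1%:R * j.+2%:R) :> rat)%R.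
  rewrite ler_pdivlMr ?mulr_gt0 ?ltr0n // -!natrM ler_nat.
  apply: leq_trans (leq_trunc_div Y (j.+2 * j.+2)).
  by rewrite leq_mul2l leq_mul2r leqnSn !orbT.
rewrite (le_trans le1) // le_eqVlt; apply/orP; left; apply/eqP.
rewrite -!natr1; field.
have H1 : (0 <= j%:R :> rat)%R by rewrite ler0n.
by rewrite !lt0r_neq0 //; lra.
Qed.

(** With the residue fixed, the quotient by [q] determines the number. *)
Lemma sum_one_class_le (Y q : nat) (P : pred nat) : 0 < q ->
  (forall i j, P i -> P j -> i = j %[mod q]) ->
  \sum_(i < Y) P i <= (Y %/ q).+1.
Proof.
move=> q0 Pq.
rewrite -(card_ord (Y %/ q).+1) -big_mkcond /= sum1_card.
have lt (i : 'I_Y) : i %/ q < (Y %/ q).+1 by rewrite ltnS leq_div2r // ltnW.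
apply: (@leq_card_in _ _ (fun i => Ordinal (lt i))) => i j Pi Pj [dij].
by apply/val_inj; rewrite /= (divn_eq i q) (divn_eq j q) dij (Pq i j).
Qed.

Lemma sum_two_classes_le (Y q : nat) (P : pred nat) : 0 < q ->
  (forall i j k, P i -> P j -> P k ->
     [\/ i = j %[mod q], i = k %[mod q] | j = k %[mod q]]) ->
  \sum_(i < Y) P i <= 2 * (Y %/ q).+1.
Proof.
move=> q0 P3.
have [/existsP[i /existsP[j /and3P[Pi Pj nij]]]|noij] := boolP
    [exists i : 'I_Y, exists j : 'I_Y, [&& P i, P j & i != j %[mod q]]].
  rewrite mul2n -addnn.
  rewrite (leq_trans (n := \sum_(k < Y) ([&& P k & k == i %[mod q]] : nat)
      + \sum_(k < Y) ([&& P k & k == j %[mod q]] : nat))) //.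
    rewrite -big_split /=; apply: leq_sum => k _.
    case Pk: (P k) => //=; case: (P3 _ _ _ Pi Pj Pk) => [/eqP E|<-|<-].
    - by rewrite E in nij.
    - by rewrite eqxx.
    - by rewrite eqxx addn1.
  by apply: leq_add; apply: (@sum_one_class_le _ _
    (fun k => P k && (k == _ %[mod q]))) => // k l /andP[_ /eqP->] /andP[_ /eqP->].
rewrite mul2n -addnn; apply: leq_trans (leq_addr _ _).
(* Here congruence of all solutions is known only below [Y], so that bound is put into the
   predicate. *)
rewrite (eq_bigr (fun i : 'I_Y => ((i < Y) && P i : nat))); last first.
  by move=> i _; rewrite ltn_ord.
apply: (@sum_one_class_le _ _ (fun i => (i < Y) && P i)) => // i j.
move=> /andP[iY Pi] /andP[jY Pj].
apply/eqP/negPn/negP => nij; case/negP: noij.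
by apply/existsP; exists (Ordinal iY); apply/existsP; exists (Ordinal jY); apply/and3P.
Qed.

(** Brings the count of pairs with p dividing both entries to the shape of the other counts. *)
Lemma div_succ_sqr_le (Y p : nat) : 0 < Y -> 0 < p ->
  (Y %/ p).+1 * (Y %/ p).+1 <= 4 * (Y * (Y %/ (p * p)).+1).
Proof.
move=> Y0 p0.
have [->|a0] := posnP (Y %/ p); first by nia.
have h1 := leq_trunc_div Y p.
have h2 : Y < (Y %/ (p * p)).+1 * (p * p) by rewrite ltn_ceil // muln_gt0 p0.
move: (Y %/ p) (Y %/ (p * p)) a0 h1 h2 => x y x0 h1 h2.
have h3 : x * x <= Y * y.+1.
  rewrite -(@leq_pmul2r (p * p)) ?muln_gt0 ?p0 //.
  rewrite (_ : x * x * (p * p) = (x * p) * (x * p)); last by ring.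
  by rewrite (leq_trans (leq_mul h1 h1)) // -mulnA leq_mul2l (ltnW h2) orbT.
nia.
Qed.

(** * The quadratic form modulo squares of primes *)

Local Open Scope ring_scope.

(** [e] is the sign attached to the angle and [B] stands for r^2; the same [B] is later the common
    difference of the progressions of u and v. *)
Definition qform (e B u v : int) : int := u ^+ 2 + 2 * e * B * u * v - (B * v) ^+ 2.

Lemma qformE (e B u v : int) : e ^+ 2 = 1 ->
  qform e B u v = 2 * u ^+ 2 - (e * u - B * v) ^+ 2.
Proof.
move=> e1; rewrite (_ : (e * u - B * v) ^+ 2 =
  e ^+ 2 * u ^+ 2 - 2 * e * B * u * v + (B * v) ^+ 2); last by ring.
by rewrite e1 /qform; ring.
Qed.

Lemma Euclid_dvdzM (p : nat) (x y : int) : prime p ->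
  (p %| x * y)%Z = (p %| x)%Z || (p %| y)%Z.
Proof. by move=> pp; rewrite !dvdzE abszM Euclid_dvdM. Qed.

Lemma coprimez_prime (p : nat) (x : int) : prime p ->
  coprimez p x = ~~ (p %| x)%Z.
Proof. by move=> pp; rewrite coprimezE prime_coprime. Qed.

Lemma coprimez_prime_sqr (p : nat) (x : int) : prime p -> ~~ (p %| x)%Z ->
  coprimez (p%:Z * p%:Z) x.
Proof.
by move=> pp px; rewrite coprimezMl !coprimez_prime // px.
Qed.

Lemma eqn_mod_of_dvdn (q s B i j : nat) : coprime q B ->
  (q %| s + B * i)%N -> (q %| s + B * j)%N -> i = j %[mod q].
Proof.
move=> qB; wlog ij : i j / (i <= j)%N.
  by move=> H qi qj; have [/H|/ltnW/H E] := leqP i j; [apply|symmetry; apply: E].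
move=> qi qj; apply/eqP; rewrite eq_sym eqn_mod_dvd //.
rewrite -(Gauss_dvdr _ qB) mulnBr.
by rewrite (_ : B * j - B * i = s + B * j - (s + B * i))%N ?dvdn_sub //; lia.
Qed.

(** An odd p dividing both x - y and x + y would divide 2x, so p^2 lies in a single factor. *)
Lemma dvdz_sqr_sub (p : nat) (x y : int) : prime p -> odd p -> ~~ (p %| x)%Z ->
  (p%:Z * p%:Z %| x ^+ 2 - y ^+ 2)%Z ->
  (p%:Z * p%:Z %| x - y)%Z \/ (p%:Z * p%:Z %| x + y)%Z.
Proof.
move=> pp op px; rewrite subr_sqr => pxy.
have [pm|pm] := boolP (p%:Z %| x - y)%Z; last first.
  by right; rewrite -(Gauss_dvdzr _ (coprimez_prime_sqr _ _ pp pm)).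
have [pD|pD] := boolP (p%:Z %| x + y)%Z; last first.
  by left; rewrite -(Gauss_dvdzl _ (coprimez_prime_sqr _ _ pp pD)).
have : (p%:Z %| 2 * x)%Z.
  rewrite (_ : 2 * x = (x - y) + (x + y)); last by ring.
  exact: rpredD pm pD.
rewrite Euclid_dvdzM // (negbTE px) orbF dvdzE /= dvdn_prime2 // => /eqP p2.
by rewrite p2 in op.
Qed.

(** For fixed u, a zero of the form makes w = e u - B v a square root of the unit 2u^2 modulo p^2.
    If w_j and w_k both differ from w_i, both equal -w_i; and w determines the index since p does
    not divide B. *)
Lemma qform_roots_mod (p B s : nat) (e u : int) (i j k : nat) :
  e ^+ 2 = 1 -> prime p -> odd p -> coprime p B -> ~~ (p %| u)%Z ->
  (p%:Z * p%:Z %| qform e B u (s + B * i)%N)%Z ->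
  (p%:Z * p%:Z %| qform e B u (s + B * j)%N)%Z ->
  (p%:Z * p%:Z %| qform e B u (s + B * k)%N)%Z ->
  [\/ i = j %[mod p * p], i = k %[mod p * p] | j = k %[mod p * p]].
Proof.
move=> e1 pp op pB pu; rewrite !qformE //.
pose w t : int := e * u - B%:Z * (s + B * t)%N%:Z.
rewrite -!/(w _) => hi hj hk.
have pw t : (p%:Z * p%:Z %| 2 * u ^+ 2 - w t ^+ 2)%Z -> ~~ (p %| w t)%Z.
  move=> pQ; apply/negP => pw.
  have : (p %| 2 * u ^+ 2)%Z.
    rewrite -[2 * _](subrK (w t ^+ 2)); apply: rpredD.
      exact: dvdz_trans (dvdz_mulr _ (dvdzz _)) pQ.
    by rewrite exprS; apply: dvdz_mulr.
  rewrite expr2 !Euclid_dvdzM // (negbTE pu) !orbF dvdzE /= dvdn_prime2 // => /eqP p2.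
  by rewrite p2 in op.
have cong t t' : (p%:Z * p%:Z %| w t - w t')%Z -> t = t' %[mod p * p].
  rewrite (_ : w t - w t' = (B%:Z * B%:Z) * (t'%:Z - t%:Z)); last first.
    by rewrite /w !PoszD !PoszM; ring.
  rewrite Gauss_dvdzr; last first.
    by rewrite coprimezMr !coprimez_prime_sqr // dvdzE /= -prime_coprime.
  move=> d; apply/eqP; rewrite -eqz_nat -!modz_nat eq_sym eqz_mod_dvd PoszM //.
have opp t t' : (p%:Z * p%:Z %| 2 * u ^+ 2 - w t ^+ 2)%Z ->
    (p%:Z * p%:Z %| 2 * u ^+ 2 - w t' ^+ 2)%Z ->
    t = t' %[mod p * p] \/ (p%:Z * p%:Z %| w t + w t')%Z.
  move=> ht ht'; case: (@dvdz_sqr_sub p (w t) (w t')) => //; first exact: pw.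
  - rewrite (_ : _ - _ = (2 * u ^+ 2 - w t' ^+ 2) - (2 * u ^+ 2 - w t ^+ 2)).
      by rewrite rpredB.
    by ring.
  - by move/cong; left.
  - by right.
case: (opp i j) => // [|ij]; first by constructor 1.
case: (opp i k) => // [|ik]; first by constructor 2.
constructor 3; apply: cong.
rewrite (_ : w j - w k = (w i + w j) - (w i + w k)) ?rpredB //; ring.
Qed.

(** The form is -(B v)^2 modulo u and u^2 modulo v. *)
Lemma prime_dvd_qform (p B : nat) (e u v : int) : prime p -> coprime p B ->
  (p %| qform e B u v)%Z -> (p %| u)%Z = (p %| v)%Z.
Proof.
move=> pp pB pQ.
have pB' : (p %| B%:Z)%Z = false.
  by apply/negbTE; rewrite dvdzE /= -prime_coprime.
apply/idP/idP => h.
- have : (p %| (B%:Z * v) ^+ 2)%Z.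
    rewrite (_ : (B%:Z * v) ^+ 2 = u * (u + 2 * e * B%:Z * v) - qform e B u v); last first.
      by rewrite /qform; ring.
    by apply: rpredB => //; apply: dvdz_mulr.
  by rewrite expr2 !Euclid_dvdzM // pB' orbb.
have : (p %| u ^+ 2)%Z.
  rewrite (_ : u ^+ 2 = qform e B u v - v * (2 * e * B%:Z * u - B%:Z ^+ 2 * v)); last first.
    by rewrite /qform; ring.
  by apply: rpredB => //; apply: dvdz_mulr.
by rewrite expr2 Euclid_dvdzM // orbb.
Qed.

Lemma dvdz_sqr_mul_qform (p B : nat) (e u v : int) : prime p -> coprime p B ->
  (p%:Z * p%:Z %| u * v * qform e B u v)%Z ->
  [|| (p%:Z * p%:Z %| u)%Z, (p%:Z * p%:Z %| v)%Z, (p %| u)%Z && (p %| v)%Z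
    | ~~ (p %| u)%Z && (p%:Z * p%:Z %| qform e B u v)%Z].
Proof.
move=> pp pB h.
have [pQ|pQ] := boolP (p %| qform e B u v)%Z.
  have := prime_dvd_qform _ _ _ _ _ pp pB pQ.
  have [pu E|pu /esym/negbT pv] := boolP (p %| u)%Z.
    by rewrite -E !orbT.
  apply/orP; right; apply/orP; right => /=.
  have puv : ~~ (p %| u * v)%Z by rewrite Euclid_dvdzM // negb_or pu pv.
  by rewrite -(Gauss_dvdzr _ (coprimez_prime_sqr _ _ pp puv)).
rewrite (Gauss_dvdzl _ (coprimez_prime_sqr _ _ pp pQ)) in h.
have [pu|pu] := boolP (p %| u)%Z; last first.
  by rewrite (Gauss_dvdzr _ (coprimez_prime_sqr _ _ pp pu)) in h; rewrite h orbT.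
have [pv|pv] := boolP (p %| v)%Z; first by rewrite !orbT.
by rewrite (Gauss_dvdzl _ (coprimez_prime_sqr _ _ pp pv)) in h; rewrite h.
Qed.

(** With q = Y/p^2 + 1 (quotient rounded down), the cases p^2 | u, p^2 | v, p dividing both, and p^2
    dividing the form with p not dividing u contribute at most Y q, Y q, 4 Y q and 2 Y q. *)
Lemma sum_dvd_sqr_qform_le (p B s t Y : nat) (e : int) :
  e ^+ 2 = 1 -> prime p -> odd p -> coprime p B -> (0 < Y)%N ->
  (\sum_(i < Y) \sum_(j < Y) ((p%:Z * p%:Z)%R %| ((s + B * i)%N%:Z * (t + B * j)%N%:Z
      * qform e B (s + B * i)%N (t + B * j)%N)%R)%Z
    <= 8 * (Y * (Y %/ (p * p)).+1))%N.
Proof.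
move=> e1 pp op pB Y0.
have p0 := prime_gt0 pp.
have pp0 : (0 < p * p)%N by rewrite muln_gt0 p0.
have ppB : coprime (p * p) B by rewrite coprimeMl pB.
set q := (Y %/ (p * p)).+1.
pose f1 i := (p * p %| s + B * i)%N.
pose f2 j := (p * p %| t + B * j)%N.
pose g1 i := (p %| s + B * i)%N.
pose g2 j := (p %| t + B * j)%N.
pose h i j := ~~ (p %| (s + B * i)%N%:Z)%Z &&
  (p%:Z * p%:Z %| qform e B (s + B * i)%N (t + B * j)%N)%Z.
have f1q : (\sum_(i < Y) f1 i <= q)%N.
  by apply: (@sum_one_class_le _ _ f1) => // i j; apply: eqn_mod_of_dvdn.
have f2q : (\sum_(i < Y) f2 i <= q)%N.
  by apply: (@sum_one_class_le _ _ f2) => // i j; apply: eqn_mod_of_dvdn.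
have g1q : (\sum_(i < Y) g1 i <= (Y %/ p).+1)%N.
  by apply: (@sum_one_class_le _ _ g1) => // i j; apply: eqn_mod_of_dvdn.
have g2q : (\sum_(i < Y) g2 i <= (Y %/ p).+1)%N.
  by apply: (@sum_one_class_le _ _ g2) => // i j; apply: eqn_mod_of_dvdn.
have hq i : (\sum_(j < Y) h i j <= 2 * q)%N.
  apply: (@sum_two_classes_le _ _ (h i)) => // j k l /andP[pu hj] /andP[_ hk] /andP[_ hl].
  exact: (@qform_roots_mod p B t e (s + B * i)%N).
rewrite (@leq_trans (\sum_(i < Y) \sum_(j < Y) (f1 i + f2 j + g1 i * g2 j + h i j))%N) //.
  apply: leq_sum => i _; apply: leq_sum => j _.
  case H: (_ %| _)%Z => //.
  have := dvdz_sqr_mul_qform _ _ _ _ _ pp pB H.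
  rewrite -PoszM /f1 /f2 /g1 /g2 /h -PoszM; rewrite !dvdzE /=.
  by case: (_ %| s + _)%N; case: (_ %| t + _)%N; case: (_ %| s + _)%N => //;
     case: (_ %| t + _)%N => //=; case: (_ %| _)%N.
rewrite (eq_bigr (fun i : 'I_Y => (Y * f1 i + \sum_(j < Y) f2 j
    + g1 i * (\sum_(j < Y) g2 j) + \sum_(j < Y) h i j)%N)); last first.
  by move=> i _; rewrite !big_split /= sum_nat_const card_ord big_distrr.
rewrite !big_split /= -big_distrr /= -big_distrl /= sum_nat_const card_ord.
have hs : (\sum_(i < Y) \sum_(j < Y) h i j <= Y * (2 * q))%N.
  rewrite -[X in (_ <= X * _)%N]card_ord -sum_nat_const.
  by apply: leq_sum => i _; apply: hq.
have gs := leq_trans (leq_mul g1q g2q) (div_succ_sqr_le Y p Y0 p0).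
have f1s := leq_mul (leqnn Y) f1q; have f2s := leq_mul (leqnn Y) f2q.
rewrite -/q in gs; rewrite mulnCA in hs.
apply: leq_trans (leq_add (leq_add (leq_add f1s f2s) gs) hs) _.
by lia.
Qed.

(** * Sieving a box of pairs (u, v) *)

(** Positivity is needed for an area; the upper bound confines the primes whose square divides the
    form to p = O(u). *)
Lemma qform_bounds (e B u v : int) : e ^+ 2 = 1 -> 0 <= B * v -> 3 * (B * v) < u ->
  0 < qform e B u v <= 2 * u ^+ 2.
Proof.
move=> /eqP; rewrite sqrf_eq1 => e1; rewrite /qform.
rewrite (_ : 2 * e * B * u * v = 2 * e * u * (B * v)); last by ring.
move: (B * v) => x x0 xu; rewrite !expr2.
by case/orP: e1 => /eqP->; apply/andP; split; nia.
Qed.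

(* The bound 32 makes the count work: the two contributions to the number of
   bad pairs are each at most 8 Y^2 / 32. *)
Lemma exists_pair_sqrfree_off (B t N : nat) (e : int) :
  e ^+ 2 = 1 -> (0 < B)%N -> (0 < t)%N ->
  (forall p, prime p -> (p <= 32)%N -> (p %| B)%N) ->
  exists i j : nat,
    [/\ (N < 1 + B * i)%N, (3 * (B * (t + B * j)) < 1 + B * i)%N &
     forall p, prime p -> coprime p B ->
       ~~ (p%:Z * p%:Z %| (1 + B * i)%N%:Z * (t + B * j)%N%:Z
             * qform e B (1 + B * i)%N (t + B * j)%N)%Z].
Proof.
move=> e1 B0 t0 small.
(* In the box, v <= (B + t) Y, so starting u at 1 + B c Y forces u > 3 B v; [D] is chosen so that 2u
   <= D Y. *)
pose c := (3 * (B + t))%N; pose D := (2 * B * c.+1)%N.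
have [n0 pi_small] := prime_count_littleo (32 * D).
pose Y := (n0 + N).+1; have Y0 : (0 < Y)%N by [].
have D0 : (0 < D)%N by rewrite /D !muln_gt0 B0.
have {}pi_small : (32 * \sum_(0 <= p < (D * Y).+1 | prime p) 1 <= Y)%N.
  rewrite -(leq_pmul2l D0) mulnA [(D * 32)%N]mulnC; apply: pi_small.
  by rewrite /Y; nia.
pose s := (1 + B * (c * Y))%N.
pose bad p i j := ((p%:Z * p%:Z)%R %| ((s + B * i)%N%:Z * (t + B * j)%N%:Z
      * qform e B (s + B * i)%N (t + B * j)%N)%R)%Z.
pose big p := prime p && coprime p B.
have uv i j : (i < Y)%N -> (j < Y)%N ->
    (3 * (B * (t + B * j)) < s + B * i)%N /\ (2 * (s + B * i) <= D * Y)%N.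
  move=> iY jY; split.
    have : (t + B * j <= (B + t) * Y)%N by nia.
    by rewrite /s /c; nia.
  rewrite /s /D; have : (B * i + B <= B * Y)%N by nia.
  nia.
have [/existsP[i /existsP[j /forallP h]]|none] := boolP [exists i : 'I_Y,
    exists j : 'I_Y, [forall p : 'I_(D * Y).+1, big p ==> ~~ bad p i j]].
  have [h1 h2] := uv i j (ltn_ord i) (ltn_ord j).
  exists (c * Y + i)%N, (j : nat); rewrite mulnDr addnA -/s; split=> //.
    by rewrite /s /c /Y; nia.
  move=> p pp pB; apply/negP => pbad.
  have /andP[Q0 Qle] : 0 < qform e B (s + B * i)%N (t + B * j)%N
      <= 2 * (s + B * i)%N%:Z ^+ 2.
    by apply: qform_bounds => //; lia.
  have vu : (t + B * j < s + B * i)%N.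
    by apply: leq_trans h1; rewrite ltnS mulnA leq_pmull // muln_gt0.
  (* Only primes up to D Y matter: p is at most u or v, or p^2 <= 2u^2. *)
  have pDY : (p < (D * Y).+1)%N.
    rewrite ltnS; case/or4P: (dvdz_sqr_mul_qform _ _ _ _ _ pp pB pbad).
    - move=> d; have := dvdz_trans (dvdz_mulr _ (dvdzz p)) d.
      by rewrite dvdzE /= => /dvdn_leq; lia.
    - move=> d; have := dvdz_trans (dvdz_mulr _ (dvdzz p)) d.
      by rewrite dvdzE /= => /dvdn_leq; lia.
    - by move=> /andP[d _]; move: d; rewrite dvdzE /= => /dvdn_leq; lia.
    move=> /andP[_]; rewrite dvdzE -PoszM => /dvdn_leq.
    rewrite absz_gt0 gt_eqF // => /(_ isT) pQ.
    have : p%:Z * p%:Z <= 2 * (s + B * i)%N%:Z ^+ 2.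
      by rewrite -PoszM (le_trans _ Qle) // -[X in _ <= X]gtz0_abs // lez_nat.
    move: h2; move: (s + B * i)%N (D * Y)%N => x y xy; rewrite expr2 => pxx.
    by clear -xy pxx; rewrite leqNgt; apply/negP => yp; nia.
  by move: (h (Ordinal pDY)); rewrite /big pp pB /= => /negP; apply.
(* Union bound: if each pair has a bad prime, the bad pairs summed over primes number at least Y^2.
   Primes up to 32 divide [B], hence the start at 33. *)
have : (Y * Y <= \sum_(33 <= p < (D * Y).+1 | big p)
    \sum_(i < Y) \sum_(j < Y) bad p i j)%N.
  rewrite exchange_big /= -{1}[Y]card_ord -sum_nat_const.
  apply: leq_sum => i _; rewrite exchange_big /= -{1}[Y]card_ord -sum1_card.
  apply: leq_sum => j _.
  move: none; rewrite negb_exists => /forallP /(_ i).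
  rewrite negb_exists => /forallP /(_ j); rewrite negb_forall => /existsP[p].
  rewrite negb_imply negbK => /andP[bp badp].
  rewrite (big_rem (p : nat)) /=; first by rewrite bp badp.
  rewrite mem_index_iota ltn_ord andbT ltnNge; apply/negP => p32.
  case/andP: bp => pp; rewrite prime_coprime // => /negP; apply; exact: small.
have odd_big p : big p -> odd p.
  move=> /andP[pp]; case: (even_prime pp) => // ->.
  by rewrite prime_coprime // small.
set S := (X in (_ <= X)%N).
have Sle : (S <= 8 * Y * (\sum_(33 <= p < (D * Y).+1) Y %/ (p * p)
    + \sum_(0 <= p < (D * Y).+1 | prime p) 1))%N.
  rewrite mulnDr !big_distrr /=.
  rewrite (@leq_trans (\sum_(33 <= p < (D * Y).+1 | big p) 8 * (Y * (Y %/ (p * p)).+1))%N) //.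
    apply: leq_sum => p bp; have /andP[pp pB] := bp.
    by apply: sum_dvd_sqr_qform_le => //; apply: odd_big.
  rewrite (eq_bigr (fun p => 8 * Y * (Y %/ (p * p)) + 8 * Y * 1)%N); last first.
    by move=> p _; lia.
  rewrite big_split leq_add //=.
    by rewrite [X in (X <= _)%N]big_mkcond leq_sum // => p _; case: ifP.
  have [le|/ltnW le] := leqP 33 (D * Y).+1; last by rewrite big_geq.
  rewrite [X in (_ <= X)%N](big_cat_nat _ (n := 33)) //=.
  apply: leq_trans (leq_addl _ _).
  rewrite [X in (X <= _)%N]big_mkcond [X in (_ <= X)%N]big_mkcond.
  by apply: leq_sum => p _; rewrite /big; case: prime => //; case: coprime.
move=> /leq_trans /(_ Sle).
have := sum_div_square_le Y 32 (D * Y).+1 isT.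
move: pi_small; set a := (X in (32 * X)%N); set b := (X in (32 * X)%N).
move=> ha hb hc; exfalso; have {ha hb} := leq_mul (leqnn Y) (leq_add ha hb).
by clear -hc Y0; nia.
Qed.

(** * A representative of the class without square factors at prescribed primes *)

(** Take t = g x with g = gcd(a, m), x = a/g modulo m/g and x = 1 modulo the part of [K] prime to
    m/g. Then x is prime to [K], so p^2 | t would give p^2 | g. *)
Lemma exists_cong_not_dvd_sqr (a m K : nat) : (0 < m)%N -> (1 < K)%N ->
  squarefree (gcdn a m) ->
  exists t, [/\ (0 < t)%N, t = a %[mod m] &
    forall p, prime p -> (p %| K)%N -> ~~ (p * p %| t)%N].
Proof.
move=> m0 K1 sqg; set g := gcdn a m.
have g0 : (0 < g)%N by rewrite gcdn_gt0 m0 orbT.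
have [a1 aE] : exists a1, a = (g * a1)%N.
  by exists (a %/ g)%N; rewrite mulnC divnK // dvdn_gcdl.
have [m1 mE] : exists m1, m = (g * m1)%N.
  by exists (m %/ g)%N; rewrite mulnC divnK // dvdn_gcdr.
have cop : coprime a1 m1.
  by rewrite /coprime -(eqn_pmul2l g0) muln1 muln_gcdr -aE -mE.
have m10 : (0 < m1)%N by move: m0; rewrite mE muln_gt0 => /andP[].
pose Kc := (K`_(\pi(m1)^'))%N.
have copK : coprime m1 Kc by rewrite coprime_pi' ?part_gt0 // part_pnat.
pose x := chinese m1 Kc a1 1.
have px p : prime p -> (p %| K)%N -> ~~ (p %| x)%N.
  move=> pp pK; have [pm1|pm1] := boolP (p %| m1)%N.
    apply/negP => px; have := chinese_modl copK a1 1 => /(congr1 (modn^~ p)).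
    rewrite !modn_dvdm // -/x => E.
    have pa1 : (p %| a1)%N by rewrite /dvdn -E.
    have : (p %| gcdn a1 m1)%N by rewrite dvdn_gcd pa1.
    by rewrite (eqP cop) dvdn1 => /eqP p1; rewrite p1 in pp.
  have pKc : (p %| Kc)%N.
    have : (p %| K`_(\pi(m1)) * Kc)%N by rewrite partnC // ltnW.
    rewrite Euclid_dvdM // => /orP[pK1|//].
    have := pnat_dvd pK1 (part_pnat _ _); rewrite pnatE // => pim.
    by move: pim; rewrite mem_primes (negbTE pm1) !andbF.
  apply/negP => px; have := chinese_modr copK a1 1 => /(congr1 (modn^~ p)).
  rewrite !modn_dvdm // -/x => E.
  have : (p %| 1)%N by rewrite /dvdn -E.
  by rewrite dvdn1 => /eqP p1; rewrite p1 in pp.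
exists (g * x)%N; split.
- rewrite muln_gt0 g0 lt0n; apply: contraNneq (px _ (pdiv_prime K1) (pdiv_dvd K)) => ->.
  exact: dvdn0.
- by rewrite aE mE -!muln_modr chinese_modl.
move=> p pp pK; apply/negP; rewrite Gauss_dvdl => [/sqg p1|].
  by rewrite p1 in pp.
by rewrite coprimeMl !prime_coprime // px.
Qed.

(** * Triangles from the form, and the conclusion *)

Definition angle_sign (th : angle) : int :=
  match th with PiOver4 => 1 | ThreePiOver4 => -1 end.

Lemma theta_congruent_qform (th : angle) (r u v n : nat) :
  (0 < r)%N -> (0 < u)%N -> (0 < v)%N -> 0 < qform (angle_sign th) (r * r)%N u v ->
  n%:Z = u%:Z * v%:Z * qform (angle_sign th) (r * r)%N u v -> theta_congruent th n.
Proof.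
set Q := qform _ _ _ _ => r0 u0 v0 Q0 nE; split.
  by rewrite -ltz_nat nE !mulr_gt0.
have r0q : (r%:R : rat) != 0 by rewrite pnatr_eq0 -lt0n.
have QE : (Q%:~R : rat) = u%:R ^+ 2 + 2 * (angle_sign th)%:~R * (r%:R * r%:R) * u%:R * v%:R
    - (r%:R * r%:R * v%:R) ^+ 2.
  by rewrite /Q /qform; rewrite !(intrD, intrM, mulrNz, rmorphXn) /= -!pmulrn natrM.
(* With V = r^2 v, the numbers u^2 - V^2, 2uV, u^2 + V^2 form a Pythagorean triple; divided by r
   they are a -+ b, b and c. *)
exists (Q%:~R / r%:R), (2 * u%:R * r%:R * v%:R),
  ((u%:R ^+ 2 + (r%:R * r%:R * v%:R) ^+ 2) / r%:R).
have ur0 : 0 < u%:R :> rat by rewrite ltr0n.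
have rr0 : 0 < r%:R :> rat by rewrite ltr0n.
have vr0 : 0 < v%:R :> rat by rewrite ltr0n.
split; first by rewrite divr_gt0 // ltr0z.
split; first by rewrite !mulr_gt0.
split; first by rewrite divr_gt0 // addr_gt0 // exprn_gt0 // !mulr_gt0.
split.
  have -> : (n%:R : rat) = u%:R * v%:R * Q%:~R.
    by rewrite -[n%:R]/(n%:Z%:~R) nE !intrM.
  by field.
by rewrite QE; case: th {Q Q0 nE QE} => /=; field.
Qed.

Theorem theorem5p4 (m : nat) (a : int) (gamma : angle) :
  (1 < m)%N ->
  squarefree `|gcdz a m%:Z|%N ->
  forall N : nat, exists n : nat,
    (N < n)%N /\ (n%:Z = a %[mod m%:Z])%Z /\ squarefree n /\ theta_congruent gamma n.
Proof.
move=> m1 sqg N; have m0 := ltnW m1.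
have e1 : angle_sign gamma ^+ 2 = 1 by case: gamma.
have [F F0 smallF] : exists2 F, (0 < F)%N &
    forall p, prime p -> (p <= 32)%N -> (p %| F)%N.
  by exists 32`!; [exact: fact_gt0|move=> p /prime_gt0 p0 p32; rewrite dvdn_fact ?p0].
(* [M] is the r of the parametrization and B = r^2. *)
pose M := (m * F)%N; pose B := (M * M)%N.
have M0 : (0 < M)%N by rewrite muln_gt0 m0.
have B0 : (0 < B)%N by rewrite muln_gt0 M0.
pose a0 := `|(a %% m)%Z|%N.
have a0E : a0%:Z = (a %% m)%Z by rewrite /a0 gez0_abs // modz_ge0 // eqz_nat -lt0n.
have [|||t [t0 ta tsq]] := @exists_cong_not_dvd_sqr a0 m M => //.
- by rewrite (leq_trans m1) // leq_pmulr.
- by have := sqg; rewrite -gcdz_modl -a0E.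
have smallB p : prime p -> (p <= 32)%N -> (p %| B)%N.
  by move=> pp p32; rewrite /B /M dvdn_mulr // dvdn_mull // smallF.
have [i [j [Nu uv off]]] := exists_pair_sqrfree_off B t N _ e1 B0 t0 smallB.
move: Nu uv off; set u := (1 + B * i)%N; set v := (t + B * j)%N => Nu uv off.
set Q := qform _ _ _ _ in off.
have u0 : (0 < u)%N by [].
have v0 : (0 < v)%N by rewrite /v; lia.
have /andP[Q0 _] : 0 < Q <= 2 * u%:Z ^+ 2 by apply: qform_bounds => //; lia.
pose k : int := 2 * angle_sign gamma * u%:Z * v%:Z - B%:Z * v%:Z ^+ 2.
have QE : Q = u%:Z ^+ 2 + B%:Z * k by rewrite /Q /qform /k; ring.
pose n : int := u%:Z * v%:Z * Q.
exists `|n|%N.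
have nE : `|n|%N%:Z = u%:Z * v%:Z * Q by rewrite gtz0_abs // !mulr_gt0.
have n0 : (0 < `|n|)%N by rewrite -ltz_nat nE !mulr_gt0.
split.
  rewrite (leq_trans Nu) // -lez_nat nE -mulrA ler_peMr //.
  by rewrite -gtz0_ge1 mulr_gt0.
split; last split.
- rewrite nE.
  have -> : (a = t %[mod m])%Z.
    by rewrite !modz_nat ta -modz_nat a0E modz_mod.
  apply/eqP; rewrite eqz_mod_dvd.
  (* Modulo [B], u = 1, Q = u^2 and v = t; the quotient comes from u^3 - 1 = (u - 1)(u^2 + u +
     1). *)
  have -> : u%:Z * v%:Z * Q - t%:Z =
      B%:Z * (i%:Z * (u%:Z ^+ 2 + u%:Z + 1) * v%:Z + j%:Z + u%:Z * v%:Z * k).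
    by rewrite QE /u /v !PoszD !PoszM; ring.
  by apply: dvdz_mulr; rewrite dvdzE /= /B /M -mulnA dvdn_mulr.
- move=> d dn; apply/eqP/negPn/negP => d1.
  have d0 : (0 < d)%N by case: d dn d1 => //; rewrite dvd0n; lia.
  have pp : prime (pdiv d) by rewrite pdiv_prime // ltn_neqAle eq_sym d1.
  have pd := pdiv_dvd d; move: (pdiv d) pp pd => p pp pd.
  have {}dn : (p%:Z * p%:Z %| u%:Z * v%:Z * Q)%Z.
    by rewrite -PoszM dvdzE /= (dvdn_trans _ dn) // dvdn_mul.
  have [pB|pB] := boolP (coprime p B); first by move/negP: (off p pp pB); apply.
  (* For p | B, both u and Q are 1 modulo p, so p^2 | v; since p | M, also p^2 | B, whence p^2 | t,
     which is excluded. *)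
  have {}pB : (p %| B)%N by move: pB; rewrite prime_coprime // negbK.
  have pM : (p %| M)%N by move: pB; rewrite Euclid_dvdM // orbb.
  have pu : ~~ (p %| u%:Z)%Z.
    rewrite dvdzE !absz_nat /u dvdn_addl; last by rewrite dvdn_mulr.
    by rewrite dvdn1; apply: contraTneq pp => ->.
  have pQ : ~~ (p %| Q)%Z.
    rewrite QE rpredDr; last by apply: dvdz_mulr; rewrite dvdzE.
    by rewrite expr2 Euclid_dvdzM // orbb.
  move: dn; rewrite (Gauss_dvdzl _ (coprimez_prime_sqr _ _ pp pQ)).
  rewrite (Gauss_dvdzr _ (coprimez_prime_sqr _ _ pp pu)) -PoszM dvdzE /= /v.
  rewrite dvdn_addl; last by rewrite dvdn_mulr // dvdn_mul.
  by apply/negP; apply: tsq.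
exact: (@theta_congruent_qform gamma M u v).
Qed.
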